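(* Let $\mathbb{K}$ be any field and let $\Delta$ be a zero-dimensional simplicial complex on $[n]=\{1,\dots,n\}$ with no loops (so $\Delta=\{\emptyset,\{1\},\dots,\{n\}\}$). Then for all $\mathbf{a}\in\mathbb{N}^n$ and $\mathbf{b}\in\{0,1\}^n$ with disjoint supports, $$\dim_{\mathbb{K}}T^2_{\mathbf{a}-\mathbf{b}}(\Delta)=\begin{cases}\max\{n-3,0\} & \text{if }\mathbf{a}=0\text{ and }\#\mathbf{b}=2,\\ 0 & \text{otherwise},\end{cases}$$ where $\#\mathbf{b}$ is the cardinality of the support of $\mathbf{b}$. In particular, $T^2(\Delta)=0$ if and only if $n\le 3$.
   Context: A simplicial complex on $[n]$ is a family of subsets of $[n]$ closed under taking subsets; no loops means $\{i\}\in\Delta$ for all $i\in[n]$. $\mathbb{N}$ includes $0$. $T^2(\Delta)$ is the second cotangent cohomology module of the Stanley-Reisner ring $S/I_\Delta$, where $S=\mathbb{K}[x_1,\dots,x_n]$ and $I=I_\Delta=\langle\prod_{i\in F}x_i : F\subseteq[n],\ F\notin\Delta\rangle$. Explicitly: let $m$ be the number of minimal monomial generators of $I$, let $d:S^m\to S$ be the $S$-linear map sending the canonical basis to these generators, $\operatorname{Syz}(I)=\ker d$, and $\operatorname{Kosz}(I)\subseteq\operatorname{Syz}(I)$ the submodule generated by all $d(f)g-d(g)f$ with $f,g\in S^m$. The quotient $\operatorname{Syz}(I)/\operatorname{Kosz}(I)$ is an $S/I$-module, and $T^2(\Delta)$ is the cokernel of the induced (restriction) map $\operatorname{Hom}_S(S^m,S/I)\to\operatorname{Hom}_{S/I}(\operatorname{Syz}(I)/\operatorname{Kosz}(I),S/I)$.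 Since $I$ is a monomial ideal, all these modules are $\mathbb{Z}^n$-graded ($\deg x_i=e_i$, with the basis elements of $S^m$ placed in degrees making $d$ homogeneous of degree $0$, and a homomorphism having degree $\mathbf{c}$ if it shifts degrees by $\mathbf{c}$). $T^2_{\mathbf{c}}(\Delta)$ denotes the component of degree $\mathbf{c}\in\mathbb{Z}^n$. *)

(* Defs.v *)
From HB Require Import structures.
From mathcomp Require Import all_boot all_order all_algebra.
From mathcomp Require Import generic_quotient ring_quotient.
From mathcomp Require Import boolp functions.
From mathcomp Require Import mpoly.

Set Implicit Arguments.
Unset Strict Implicit.
Unset Printing Implicit Defensive.

Import GRing.Theory.
Local Open Scope ring_scope.
Local Open Scope quotient_scope.

Section Submodules.
Variables (R : pzRingType) (V : lmodType R).

Definition gen_submod (G : V -> Prop) : {pred V} :=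
  [pred v | `[< forall N : {pred V}, GRing.submod_closed N ->
                 (forall g, G g -> g \in N) -> v \in N >]].

Lemma mem_gen_submod (G : V -> Prop) g : G g -> g \in gen_submod G.
Proof. by move=> Gg; apply/asboolP => N _; apply. Qed.

Lemma gen_submod_min (G : V -> Prop) (N : {pred V}) :
  GRing.submod_closed N -> (forall g, G g -> g \in N) ->
  {subset gen_submod G <= N}.
Proof. by move=> Nclosed GN v /asboolP; apply. Qed.

Lemma gen_submod_closed (G : V -> Prop) : GRing.submod_closed (gen_submod G).
Proof.
split; first by apply/asboolP => N [].
move=> a u v uG vG; apply/asboolP => N Nclosed GN.
by apply: (Nclosed.2); apply: (gen_submod_min Nclosed GN).
Qed.

HB.instance Definition _ (G : V -> Prop) :=
  GRing.isSubmodClosed.Build R V (gen_submod G) (gen_submod_closed G).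

Variable N : submodClosed V.

Definition submod_pred : {pred V} := N.

Fact submod_pred_closed : zmod_closed submod_pred.
Proof. by split=> [|u v uN vN]; [exact: rpred0 | rewrite -scaleN1r rpredD ?rpredZ]. Qed.

HB.instance Definition _ := GRing.isZmodClosed.Build V submod_pred
  submod_pred_closed.

Definition quotmod : Type := Quotient.quot submod_pred.

HB.instance Definition _ := GRing.Zmodule.on quotmod.

Definition pi_mod (v : V) : quotmod := \pi_(Quotient.quot submod_pred) v.

Lemma pi_mod_eq u v : (pi_mod u = pi_mod v) <-> (u - v \in N).
Proof.
rewrite -[_ \in N]/(u - v \in submod_pred) Quotient.idealrBE.
by split=> /eqP.
Qed.

Lemma pi_mod_surj (q : quotmod) : exists v, q = pi_mod v.
Proof. by exists (repr (q : Quotient.quot submod_pred)); rewrite /pi_mod reprK. Qed.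

Lemma pi_modB : {morph pi_mod : u v / u - v}.
Proof. by move=> u v; rewrite /pi_mod raddfB. Qed.

Lemma pi_modD : {morph pi_mod : u v / u + v}.
Proof. by move=> u v; rewrite /pi_mod raddfD. Qed.

Definition scale_quotmod (a : R) (q : quotmod) : quotmod :=
  pi_mod (a *: repr (q : Quotient.quot submod_pred)).

Lemma scale_pi_mod a v : scale_quotmod a (pi_mod v) = pi_mod (a *: v).
Proof.
apply/pi_mod_eq; rewrite -scalerBr rpredZ //; apply/pi_mod_eq.
by rewrite /pi_mod reprK.
Qed.

Fact scale_quotmodA a b q :
  scale_quotmod a (scale_quotmod b q) = scale_quotmod (a * b) q.
Proof. by case: (pi_mod_surj q) => v ->; rewrite !scale_pi_mod scalerA. Qed.

Fact scale_quotmod1 : left_id 1 scale_quotmod.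
Proof. by move=> q; case: (pi_mod_surj q) => v ->; rewrite scale_pi_mod scale1r. Qed.

Fact scale_quotmodDr : right_distributive scale_quotmod +%R.
Proof.
move=> a q r; case: (pi_mod_surj q) => v ->; case: (pi_mod_surj r) => w ->.
by rewrite -pi_modD !scale_pi_mod scalerDr pi_modD.
Qed.

Fact scale_quotmodDl q : {morph scale_quotmod^~ q : a b / a + b}.
Proof.
move=> a b; case: (pi_mod_surj q) => v ->.
by rewrite !scale_pi_mod scalerDl pi_modD.
Qed.

HB.instance Definition _ := GRing.Zmodule_isLmodule.Build R quotmod
  scale_quotmodA scale_quotmod1 scale_quotmodDr scale_quotmodDl.

Fact pi_mod_is_linear : linear pi_mod.
Proof. by move=> a u v; rewrite pi_modD -scale_pi_mod. Qed.

HB.instance Definition _ := GRing.isLinear.Build R V quotmod _ pi_mod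
  pi_mod_is_linear.

End Submodules.

Section Hom.
Variables (R : comPzRingType) (U V : lmodType R).

Definition linear_pred : {pred U -> V} := [pred f | `[< linear f >]].

Fact linear_pred_closed : GRing.submod_closed linear_pred.
Proof.
split=> [|a f g /asboolP flin /asboolP glin]; apply/asboolP => b u v.
  by rewrite -[LHS]/0 -[0 u]/0 -[0 v]/0 scaler0 addr0.
have E w : (a *: f + g) w = a *: f w + g w by [].
by rewrite !E flin glin !scalerDr !scalerA mulrC addrACA.
Qed.

HB.instance Definition _ := GRing.isSubmodClosed.Build R (U -> V)
  linear_pred linear_pred_closed.

Record Hom := MkHom { hom_fun :> U -> V; _ : hom_fun \in linear_pred }.

HB.instance Definition _ := [isSub for hom_fun].
HB.instance Definition _ := [Choice of Hom by <:].
HB.instance Definition _ := [SubChoice_isSubLmodule of Hom by <:].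

Fact Hom_is_linear (f : Hom) : linear f.
Proof. by apply/asboolP; case: f. Qed.

HB.instance Definition _ (f : Hom) :=
  GRing.isLinear.Build R U V _ (hom_fun f) (Hom_is_linear f).

End Hom.

Section Complexes.
Variables (n : nat) (D : {set {set 'I_n}}).

Definition is_complex : Prop :=
  forall F G : {set 'I_n}, F \in D -> G \subset F -> G \in D.

Definition no_loops : Prop := forall i : 'I_n, [set i] \in D.

Definition cplx_dim : int := (\max_(F in D) #|F|)%:Z - 1.

End Complexes.

Section Cotangent.
Variables (K : fieldType) (n : nat) (D : {set {set 'I_n}}).

Local Notation S := {mpoly K[n]}.

Definition set_mnm (F : {set 'I_n}) : 'X_{1..n} :=
  [multinom (i \in F : nat) | i < n].

Definition SR_ideal : {pred S^o} :=
  gen_submod (fun f : S^o => exists2 F : {set 'I_n}, F \notin D & f = 'X_[set_mnm F]).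

HB.instance Definition _ := GRing.SubmodClosed.on SR_ideal.

Definition SR_ring : lmodType S := quotmod SR_ideal.

(* The supports of the minimal monomial generators of I: those F outside D
   such that x^F is divisible by no other x^G with G outside D. *)
Definition min_gens : {set {set 'I_n}} :=
  [set F | (F \notin D) &&
    [forall G : {set 'I_n}, (G \notin D) && (set_mnm G <= set_mnm F)%MM ==> (G == F)]].

Local Notation m := #|min_gens|.

Definition gen_mnm (j : 'I_m) : 'X_{1..n} := set_mnm (enum_val j).

Local Notation Sm := 'rV[S]_m.

Definition dmap (v : Sm) : S := \sum_j v 0 j * 'X_[gen_mnm j].

Fact dmap_is_linear : linear (dmap : Sm -> S^o).
Proof.
move=> a u v; rewrite /dmap scaler_sumr -big_split /=; apply: eq_bigr => j _.
by rewrite !mxE mulrDl -mulrA.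
Qed.

HB.instance Definition _ :=
  GRing.isLinear.Build S Sm S^o _ (dmap : Sm -> S^o) dmap_is_linear.

Definition syz_pred : {pred Sm} := [pred v | dmap v == 0].

Fact syz_pred_closed : GRing.submod_closed syz_pred.
Proof.
split=> [|a u v /eqP du /eqP dv]; apply/eqP; first exact: linear0.
by rewrite dmap_is_linear du dv scaler0 addr0.
Qed.

HB.instance Definition _ := GRing.isSubmodClosed.Build S Sm
  syz_pred syz_pred_closed.

Record Syz := MkSyz { syz_val :> Sm; _ : syz_val \in syz_pred }.

HB.instance Definition _ := [isSub for syz_val].
HB.instance Definition _ := [Choice of Syz by <:].
HB.instance Definition _ := [SubChoice_isSubLmodule of Syz by <:].

Definition kosz_pred : {pred Sm} :=
  gen_submod (fun v : Sm => exists f g : Sm, v = dmap f *: g - dmap g *: f).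

HB.instance Definition _ := GRing.SubmodClosed.on kosz_pred.

Definition Kosz : {pred Syz} := [pred s | syz_val s \in kosz_pred].

Fact Kosz_closed : GRing.submod_closed Kosz.
Proof.
split=> [|a u v uK vK]; rewrite inE; first exact: rpred0.
exact: (gen_submod_closed _).2.
Qed.

HB.instance Definition _ := GRing.isSubmodClosed.Build S Syz Kosz Kosz_closed.

Definition SyzKosz : lmodType S := quotmod Kosz.

(* I annihilates both Syz/Kosz and S/I (see SyzKosz_annihil and
   SR_ring_annihil), so their S/I-module structures are induced by the
   S-module structures and the S/I-linear maps between them are exactly the
   S-linear ones. *)
Definition HomSyzKosz : lmodType S := Hom SyzKosz SR_ring.

(* Image of Hom_S(S^m, S/I) under restriction to Syz(I). *)
Definition restr_image : {pred HomSyzKosz} :=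
  [pred phi : HomSyzKosz | `[< exists psi : Hom Sm SR_ring,
     forall s : Syz, phi (pi_mod Kosz s) = psi (syz_val s) >]].

Fact restr_image_closed : GRing.submod_closed restr_image.
Proof.
split=> [|a f g /asboolP[p fp] /asboolP[q gq]]; apply/asboolP.
  by exists 0.
by exists (a *: p + q) => s; rewrite -[LHS]/(a *: f _ + g _) fp gq.
Qed.

HB.instance Definition _ := GRing.isSubmodClosed.Build S HomSyzKosz
  restr_image restr_image_closed.

Definition T2 : lmodType S := quotmod restr_image.

Local Notation deg := {ffun 'I_n -> int}.

Definition degZ (e : 'X_{1..n}) : deg := [ffun i => (e i)%:Z].

(* f is homogeneous of degree u; only f = 0 is when u has a negative entry. *)
Definition homogS (u : deg) (f : S) : Prop :=
  forall e, e \in msupp f -> degZ e = u.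

(* The j-th basis vector of S^m sits in the degree of the j-th generator. *)
Definition homogSm (u : deg) (v : Sm) : Prop :=
  forall j, homogS (u - degZ (gen_mnm j)) (v 0 j).

Definition homogSR (u : deg) (x : SR_ring) : Prop :=
  exists2 f : S^o, homogS u f & x = pi_mod SR_ideal f.

Definition homogSyzKosz (u : deg) (x : SyzKosz) : Prop :=
  exists2 s : Syz, homogSm u (syz_val s) & x = pi_mod Kosz s.

Definition homogHom (c : deg) (phi : HomSyzKosz) : Prop :=
  forall u x, homogSyzKosz u x -> homogSR (u + c) (phi x).

Definition T2_comp (c : deg) (t : T2) : Prop :=
  exists2 phi : HomSyzKosz, homogHom c phi & t = pi_mod restr_image phi.

End Cotangent.

(* The K-subspace U of a module over K[x_1,...,x_n] (K acting through constant
   polynomials) has a basis consisting of k elements. *)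
Definition has_dimK (K : fieldType) (n : nat) (V : lmodType {mpoly K[n]})
    (U : V -> Prop) (k : nat) : Prop :=
  exists b : 'I_k -> V,
    [/\ forall i, U (b i),
        forall a : 'I_k -> K, \sum_i (a i)%:MP *: b i = 0 -> forall i, a i = 0
      & forall v, U v -> exists a : 'I_k -> K, v = \sum_i (a i)%:MP *: b i].

Definition supp (n : nat) (e : 'X_{1..n}) : {set 'I_n} := [set i | e i != 0%N].

Section Annihilation.
Variables (K : fieldType) (n : nat) (D : {set {set 'I_n}}).

Lemma set_mnm_le (F G : {set 'I_n}) :
  (set_mnm F <= set_mnm G)%MM = (F \subset G).
Proof.
apply/mnm_lepP/subsetP => [le_FG i iF | sFG i].
  by have := le_FG i; rewrite !mnmE iF; case: (i \in G).
by rewrite !mnmE; case: (boolP (i \in F)) => // /sFG ->.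
Qed.

Lemma min_gens_le (F : {set 'I_n}) :
  F \notin D -> exists2 G, G \in min_gens D & G \subset F.
Proof.
move=> FD; pose P := [pred G : {set 'I_n} | (G \notin D) && (G \subset F)].
have PF : P F by rewrite /= FD subxx.
case: (arg_minnP (fun G : {set 'I_n} => #|G|) PF) => G /andP[GD sGF] Gmin.
exists G => //; rewrite inE GD; apply/forallP => H; apply/implyP.
rewrite set_mnm_le => /andP[HD sHG]; rewrite eqEcard sHG.
by apply: Gmin; rewrite /= HD (subset_trans sHG).
Qed.

Lemma SR_idealE (f : {mpoly K[n]}^o) :
  f \in SR_ideal D -> exists v : 'rV_#|min_gens D|, f = dmap v.
Proof.
pose N : {pred {mpoly K[n]}^o} :=
  [pred f | `[< exists v : 'rV_#|min_gens D|, f = dmap v >]].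
have Ncl : GRing.submod_closed N.
  split; first by apply/asboolP; exists 0; rewrite linear0.
  move=> a u v /asboolP[x ->] /asboolP[y ->]; apply/asboolP.
  by exists (a *: x + y); rewrite dmap_is_linear.
move=> fI; apply/asboolP; move: f fI; apply: (gen_submod_min Ncl) => _ [F FD ->].
have [G GM sGF] := min_gens_le FD.
apply/asboolP; exists ('X_[set_mnm F - set_mnm G] *: delta_mx 0 (enum_rank_in GM G)).
rewrite /dmap (bigD1 (enum_rank_in GM G)) //= big1 => [|j nj]; last first.
  by rewrite !mxE (negPf nj) andbF mulr0 mul0r.
rewrite addr0 !mxE !eqxx mulr1 /gen_mnm enum_rankK_in // -mpolyXD submK //.
by rewrite set_mnm_le.
Qed.

Lemma SyzKosz_annihil (f : {mpoly K[n]}^o) (x : SyzKosz K D) :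
  f \in SR_ideal D -> f *: x = 0.
Proof.
move=> /SR_idealE[v ->]; case: (pi_mod_surj x) => s ->.
rewrite -linearZ -(linear0 (pi_mod (Kosz (K := K) (D := D)))).
apply/pi_mod_eq; rewrite subr0 inE; apply: mem_gen_submod.
by exists v, (syz_val s); case: s => s /= /eqP ->; rewrite scale0r subr0.
Qed.

Lemma SR_ring_annihil (f : {mpoly K[n]}^o) (x : SR_ring K D) :
  f \in SR_ideal D -> f *: x = 0.
Proof.
move=> fI; case: (pi_mod_surj x) => g ->.
rewrite -linearZ -(linear0 (pi_mod (SR_ideal D))).
have fg : f *: g = (g : {mpoly K[n]}) *: f by rewrite /GRing.scale /= mulrC.
by apply/pi_mod_eq; rewrite subr0 fg rpredZ.
Qed.

End Annihilation.

(* Main.v *)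
(** The ideal [I] is generated by the [x_i x_j] with [i < j], and [S/I] embeds
    into the product of the rings [K[x_l]] by setting all variables but [x_l] to
    zero. The module [Syz(I)/Kosz(I)] is generated by the
    [x_k e_ij - x_j e_ik]. Since [x_i] times such a syzygy is a Koszul relation,
    and by the cocycle relations between three Taylor syzygies, a homomorphism
    [phi] satisfies
        phi (x_k e_ij - x_j e_ik) = a_(ij,k) - a_(ik,j)
    where [a_(ij,k)] lies in [x_k K[x_k]] and depends only on the edge [ij] and
    the vertex [k]. The part of [a_(ij,k)] divisible by [x_k ^ 2] comes from a map
    on [S^m]. Hence [T^2] is spanned over [K] by the classes of the
    homomorphisms [s |-> s_ij(0, ..., x_k, ..., 0)], of degree [- e_i - e_j], for
    [k] outside [ij]. The image of [e_ij |-> c] is [c] times their sum over [k],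
    and these are the only relations, which gives dimension [(n - 2) - 1] for
    each edge. *)
Require Import Defs.
From HB Require Import structures.
From mathcomp Require Import all_boot all_order all_algebra.
From mathcomp Require Import generic_quotient ring_quotient.
From mathcomp Require Import boolp functions.
From mathcomp Require Import mpoly.
From mathcomp Require Import zify.

Import GRing.Theory.
Local Open Scope ring_scope.
Local Open Scope quotient_scope.

Set Implicit Arguments.
Unset Strict Implicit.
Unset Printing Implicit Defensive.

(** * Restriction of polynomials to coordinate subspaces *)

Section Restriction.
Variables (K : fieldType) (n : nat).
Local Notation S := {mpoly K[n]}.
Implicit Types (A B : {set 'I_n}) (f g : S) (m : 'X_{1..n}) (i k l : 'I_n).

Lemma mpoly_span_ind (P : S -> Prop) :
    P 0 -> (forall c f g, P f -> P g -> P (c *: f + g)) ->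
  (forall m, P 'X_[m]) -> forall f, P f.
Proof.
by move=> P0 PD PX; elim/mpolyind => // c m f _ _ Pf; apply: PD.
Qed.

Lemma mpolyX_neq0 m : 'X_[m] != 0 :> S.
Proof. by rewrite -msize_poly_eq0 msizeX. Qed.

Lemma set_mnm1 k : set_mnm [set k] = U_(k)%MM.
Proof. by apply/mnmP => i; rewrite mnmE mnm1E inE eq_sym. Qed.

Lemma set_mnm0 : set_mnm (set0 : {set 'I_n}) = 0%MM.
Proof. by apply/mnmP => i; rewrite mnmE mnm0E inE. Qed.

(** The retraction of [S] onto the polynomials in the variables of [A], kept as an endomorphism of
    [S] so that restrictions to different subspaces compose. *)
Definition res A : S -> S :=
  comp_mpoly [tuple if i \in A then 'X_i else 0 | i < n].

HB.instance Definition _ A := GRing.RMorphism.copy (res A)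
  (comp_mpoly [tuple if i \in A then 'X_i else 0 : S | i < n]).
HB.instance Definition _ A := GRing.Linear.copy (res A)
  (comp_mpoly [tuple if i \in A then 'X_i else 0 : S | i < n]).

Lemma resMP A (c : K) : res A c%:MP = c%:MP.
Proof. exact: comp_mpolyC. Qed.

Lemma resX A m : res A 'X_[m] = if supp m \subset A then 'X_[m] else 0.
Proof.
rewrite /res comp_mpolyX; under eq_bigr do rewrite tnth_mktuple.
case: subsetP => [sA|nsA].
  rewrite [RHS]mpolyXE_id; apply: eq_bigr => i _.
  case: ifP => // /negbT iA.
  have: i \notin supp m by apply: contra iA; apply: sA.
  by rewrite inE negbK => /eqP ->; rewrite !expr0.
have /existsP[i /andP[im iA]] : [exists i, (i \in supp m) && (i \notin A)].
  rewrite -negb_forall_in; apply/negP => /forallP h; apply: nsA => i im.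
  by have := h i; rewrite im.
rewrite (bigD1 i) //= (negPf iA) expr0n; move: im; rewrite inE => /negPf ->.
by rewrite mul0r.
Qed.

Lemma supp_set_mnm A : supp (set_mnm A) = A.
Proof. by apply/setP => i; rewrite inE mnmE; case: (i \in A). Qed.

Lemma res_set_mnm A B :
  res A 'X_[set_mnm B] = if B \subset A then 'X_[set_mnm B] else 0.
Proof. by rewrite resX supp_set_mnm. Qed.

Lemma res_res A B f : res A (res B f) = res (A :&: B) f.
Proof.
elim/mpoly_span_ind: f => [|c f g If Ig|m]; first by rewrite !raddf0.
  by rewrite !linearP /= If Ig.
by rewrite !resX subsetI andbC; case: ifP => _; rewrite ?raddf0 ?resX.
Qed.

Lemma res_set0 f : res set0 f = (f@_0%MM)%:MP.
Proof.
elim/mpoly_span_ind: f => [|c f g If Ig|m].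
- by rewrite mcoeff0 raddf0.
- by rewrite linearP /= If Ig mcoeffD mcoeffZ mpolyCD mpolyCM mul_mpolyC.
rewrite resX mcoeffX subset0; have ->: (supp m == set0) = (m == 0%MM).
  apply/eqP/eqP => [/setP s0|->]; last by apply/setP => i; rewrite !inE mnm0E.
  by apply/mnmP => i; have := s0 i; rewrite !inE mnm0E => /negbFE/eqP.
by case: eqP => [->|]; rewrite ?mpolyX0 ?mpolyC1 ?mpolyC0.
Qed.

Lemma coeff_res A f m : (res A f)@_m = if supp m \subset A then f@_m else 0.
Proof.
elim/mpoly_span_ind: f => [|c f g If Ig|m'].
- by rewrite raddf0 mcoeff0 if_same.
- by rewrite linearP /= !mcoeffD !mcoeffZ If Ig; case: ifP; rewrite ?mulr0 ?addr0.
rewrite resX mcoeffX; case: (eqVneq m' m) => [<-|mm'].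
  by case: ifP; rewrite ?mcoeffX ?eqxx ?mcoeff0.
by rewrite if_same; case: ifP; rewrite ?mcoeffX ?(negPf mm') ?mcoeff0.
Qed.

Lemma res1_divX k f : exists g,
  res [set k] f = res set0 f + 'X_k * res [set k] g.
Proof.
elim/mpoly_span_ind: f => [|c f g [f' If] [g' Ig]|m].
- by exists 0; rewrite !raddf0 mulr0 addr0.
- exists (c *: f' + g'); rewrite !linearP /= If Ig mulrDr scalerDr -scalerAr.
  by rewrite addrACA.
case: (posnP (m k)) => mk.
  exists 0; rewrite raddf0 mulr0 addr0 !resX.
  suff -> : (supp m \subset [set k]) = (supp m \subset set0) by [].
  apply/subsetP/subsetP => h i im; have := h i im; rewrite !inE //.
  by move=> /eqP ik; move: im; rewrite ik inE mk eqxx.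
exists 'X_[m - U_(k)]; rewrite [res set0 _]resX ifN ?add0r; last first.
  by apply/negP => /subsetP/(_ k); rewrite !inE -lt0n mk => /(_ isT).
have {1}-> : 'X_[m] = 'X_k * 'X_[m - U_(k)] :> S.
  by rewrite -mpolyXD addmC submK // lep1mP -lt0n.
rewrite rmorphM /= [res _ 'X_k]resX.
suff -> : supp U_(k)%MM \subset [set k] by [].
by apply/subsetP => i; rewrite !inE mnm1E eqb0 negbK eq_sym.
Qed.

End Restriction.

Lemma add_cyclic_sub (V : zmodType) (a b c : V) : (a - b) + (b - c) + (c - a) = 0.
Proof. by rewrite [X in X + _]addrA subrK addrA subrK subrr. Qed.

(** * Homomorphisms out of a quotient module *)

Section HomLift.
Variables (R : comPzRingType) (V : lmodType R) (N : submodClosed V).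
Variables (W : lmodType R) (h : V -> W).
Hypotheses (h_lin : linear h) (h_ker : forall v, v \in N -> h v = 0).

Definition quot_lift (q : quotmod N) : W :=
  h (repr (q : Quotient.quot (submod_pred N))).

(** Two representatives of a class differ by an element of [N], where [h] vanishes. *)
Lemma quot_liftE v : quot_lift (pi_mod N v) = h v.
Proof.
pose h' := HB.pack_for {linear V -> W} h (GRing.isLinear.Build R V W _ h h_lin).
rewrite /quot_lift; set w := repr _; have /pi_mod_eq wv : pi_mod N w = pi_mod N v.
  by rewrite /pi_mod reprK.
have hB : h (w - v) = h w - h v by exact: (raddfB h').
by apply/eqP; rewrite -subr_eq0 -hB h_ker.
Qed.

Lemma quot_lift_linear : quot_lift \in @linear_pred R (quotmod N) W.
Proof.
apply/asboolP => a q r; case: (pi_mod_surj q) => v ->.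
by case: (pi_mod_surj r) => w ->; rewrite -linearP !quot_liftE h_lin.
Qed.

Definition hom_lift : Defs.Hom (quotmod N) W := Defs.MkHom quot_lift_linear.

End HomLift.

Section HomEval.
Variables (R : comPzRingType) (U V : lmodType R).

Lemma HomD (f g : Defs.Hom U V) x : (f + g) x = f x + g x. Proof. by []. Qed.
Lemma Hom0 x : (0 : Defs.Hom U V) x = 0. Proof. by []. Qed.

Lemma Hom_sum (J : Type) (r : seq J) (P : pred J) (f : J -> Defs.Hom U V) x :
  (\sum_(j <- r | P j) f j) x = \sum_(j <- r | P j) f j x.
Proof.
exact: (big_morph (fun f : Defs.Hom U V => f x)
  (fun f g => HomD f g x) (Hom0 x)).
Qed.

End HomEval.

(** * Dimensions over the ground field *)

Section HasDimK.
Variables (K : fieldType) (n : nat) (V : lmodType {mpoly K[n]}) (U : V -> Prop).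

Lemma has_dimK0 : (forall v, U v -> v = 0) -> has_dimK U 0.
Proof.
move=> U0; exists (fun=> 0); split=> [[]|a _ []|v /U0 ->] //.
by exists (fun=> 0); rewrite big_ord0.
Qed.

Lemma has_dimK_finset (T : finType) (B : {set T}) (f : T -> V) :
    (forall x, x \in B -> U (f x)) ->
    (forall a : T -> K, \sum_(x in B) (a x)%:MP *: f x = 0 ->
       forall x, x \in B -> a x = 0) ->
    (forall v, U v -> exists a : T -> K, v = \sum_(x in B) (a x)%:MP *: f x) ->
  has_dimK U #|B|.
Proof.
move=> Uf f_free f_span; exists (fun i => f (enum_val i)); split=> [i|a a0 i|v].
- exact/Uf/enum_valP.
(* Coefficients are transported to [T] along the enumeration of [B]; the default 0 occurs only off
   [B]. *)
- pose a' x := if [pick i : 'I_#|B| | enum_val i == x] is Some i then a i else 0.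
  have a'E j : a' (enum_val j) = a j.
    rewrite /a'; case: pickP => [h /eqP/enum_val_inj -> //|/(_ j)].
    by rewrite eqxx.
  rewrite -a'E; apply: f_free (enum_valP i); rewrite big_enum_val -[RHS]a0.
  by apply: eq_bigr => j _; rewrite a'E.
move=> /f_span[a ->]; exists (fun i => a (enum_val i)).
by rewrite big_enum_val.
Qed.

End HasDimK.

(** * Taylor syzygies of the minimal generators *)

Section TaylorSyzygies.
Variables (K : fieldType) (n : nat) (D : {set {set 'I_n}}).
Local Notation S := {mpoly K[n]}.
Local Notation m := #|min_gens D|.
Local Notation Sm := 'rV[S]_m.
Implicit Types (i j : 'I_m) (e : 'X_{1..n}) (v w : Sm).

Definition gen_set i : {set 'I_n} := enum_val i.

(** The generators are squarefree, so the cofactors of their lcm are given by set differences. *)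
Definition taylor i j : Sm :=
  'X_[set_mnm (gen_set j :\: gen_set i)] *: delta_mx 0 i
  - 'X_[set_mnm (gen_set i :\: gen_set j)] *: delta_mx 0 j.

Lemma dmapD v w : dmap (v + w) = dmap v + dmap w :> S.
Proof. exact: linearD. Qed.

Lemma dmapZ (f : S) v : dmap (f *: v) = f * dmap v.
Proof. exact: linearZ. Qed.

Lemma dmap_deltaZ (f : S) i : dmap (f *: delta_mx 0 i : Sm) = f * 'X_[gen_mnm i].
Proof.
rewrite /dmap (bigD1 i) //= big1 => [|j nj].
  by rewrite !mxE !eqxx mulr1 addr0.
by rewrite !mxE (negPf nj) andbF mulr0 mul0r.
Qed.

Lemma dmap_taylor i j : dmap (taylor i j) = 0.
Proof.
rewrite /taylor linearB /= !dmap_deltaZ -!mpolyXD; apply/eqP; rewrite subr_eq0.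
apply/eqP; congr 'X_[_]; apply/mnmP => k; rewrite !mnmE !inE.
by case: (_ \in _); case: (_ \in _).
Qed.

Lemma gen_set_inj : injective gen_set. Proof. exact: enum_val_inj. Qed.

Lemma gen_mnm_inj : injective (fun i : 'I_m => degZ (gen_mnm i)).
Proof.
move=> i j /ffunP ij; apply/gen_set_inj/setP => k.
by have := ij k; rewrite !ffunE !mnmE; do 2!case: (k \in _).
Qed.

(** Disjoint supports make [a] and [b] the positive and negative parts of the degree, so both can be
    read off from it. *)
Lemma degZB_gen (a b : 'X_{1..n}) i : [disjoint supp a & supp b] ->
  degZ a - degZ b = - degZ (gen_mnm i) -> a = 0%MM /\ supp b = gen_set i.
Proof.
move=> /pred0P ab /ffunP abi.
have abE k : a k = 0%N /\ b k = (k \in gen_set i : nat).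
  have := abi k; have := ab k; rewrite !ffunE !mnmE /= !inE /gen_set.
  by case: (k \in _) => /=; case: (a k) (b k) => [|?] [|?] //=; lia.
split; first by apply/mnmP => k; rewrite mnm0E (abE k).1.
by apply/setP => k; rewrite inE (abE k).2; case: (_ \in _).
Qed.

(** Lifted to the common degree [F], a Taylor syzygy is a difference of a term in [i] and a term in
    [j], so sums around a cycle telescope. *)
Lemma scale_taylor i j (F : {set 'I_n}) : gen_set i :|: gen_set j \subset F ->
  'X_[set_mnm (F :\: (gen_set i :|: gen_set j))] *: taylor i j
    = 'X_[set_mnm (F :\: gen_set i)] *: delta_mx 0 i
      - 'X_[set_mnm (F :\: gen_set j)] *: delta_mx 0 j.
Proof.
move=> /subsetP sF; rewrite /taylor scalerBr !scalerA -!mpolyXD.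
congr ('X_[_] *: _ - 'X_[_] *: _); apply/mnmP => k; have := sF k;
  rewrite !mnmE !inE;
  by move: (k \in gen_set i) (k \in gen_set j) (k \in F) => [] [] [] //= /(_ isT).
Qed.

(* Modulo the Taylor syzygies all the [X^(e - gen_mnm i) *: delta_mx 0 i] with
   a common [e] agree, so that [v] reduces to a section of [dmap] evaluated at
   [dmap v]. *)
Lemma syz_gen_taylor v : v \in @syz_pred K n D ->
  v \in gen_submod (fun w => exists i j, w = taylor i j).
Proof.
set N := gen_submod _ => /eqP dv.
pose nf e : Sm := if [pick i | (gen_mnm i <= e)%MM] is Some i
  then 'X_[e - gen_mnm i] *: delta_mx 0 i else 0.
have nfP e i : 'X_[e] *: delta_mx 0 i - nf (e + gen_mnm i)%MM \in N.
  rewrite /nf; case: pickP => [j|/(_ i)]; last by rewrite lem_addl.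
  move=> /mnm_lepP le_j.
  have -> : 'X_[e] *: delta_mx 0 i - 'X_[e + gen_mnm i - gen_mnm j] *: delta_mx 0 j
     = 'X_[e - set_mnm (gen_set j :\: gen_set i)] *: taylor i j :> Sm.
    rewrite /taylor scalerBr !scalerA -!mpolyXD; congr ('X_[_] *: _ - 'X_[_] *: _).
      apply/mnmP => k; have := le_j k; rewrite !mnmE !inE.
      by do 2!case: (_ \in _) => //=; lia.
    apply/mnmP => k; have := le_j k; rewrite !mnmE !inE.
    by do 2!case: (_ \in _) => //=; lia.
  by rewrite rpredZ // mem_gen_submod //; exists i, j.
(* [msize] exceeds the degree by one, so [w] strictly bounds the degree of every monomial that
   arises when [dmap] is applied to the terms of [v]. *)
pose w := (\max_i msize (v 0%R i) + \max_i mdeg (@gen_mnm n D i))%N.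
pose rho (f : S) : Sm := \sum_(e : 'X_{1..n < w}) (f@_e)%:MP *: nf e.
have rhoX e : (mdeg e < w)%N -> rho 'X_[e] = nf e.
  move=> ew; rewrite /rho (bigD1 (BMultinom ew)) //= big1 => [|e' ne'].
    by rewrite mcoeffX eqxx mpolyC1 scale1r addr0.
  rewrite mcoeffX; case: eqP => [ee'|_]; last by rewrite mpolyC0 scale0r.
  by case/eqP: ne'; apply: val_inj.
have rhoD f g : rho (f + g) = rho f + rho g.
  by rewrite -big_split; apply: eq_bigr => e _; rewrite mcoeffD mpolyCD scalerDl.
have rhoZ c f : rho (c *: f) = c%:MP *: rho f.
  rewrite scaler_sumr; apply: eq_bigr => e _.
  by rewrite mcoeffZ mpolyCM scalerA.
have rho0 : rho 0 = 0 by rewrite -(scale0r 0) rhoZ mpolyC0 scale0r.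
have -> : v = v - rho (dmap v) by rewrite dv rho0 subr0.
have -> : v = \sum_i \sum_(e <- msupp (v 0 i))
    ((v 0 i)@_e)%:MP *: ('X_[e] *: delta_mx 0 i).
  rewrite [LHS]row_sum_delta; apply: eq_bigr => i _.
  rewrite {1}[v 0 i]mpolyE scaler_suml; apply: eq_bigr => e _.
  by rewrite -mul_mpolyC scalerA.
have rho_dmapD (x y : Sm) : rho (dmap (x + y)) = rho (dmap x) + rho (dmap y).
  by rewrite dmapD rhoD.
have rho_dmap0 : rho (dmap (0 : Sm)) = 0 by rewrite linear0.
have rho_sum (J : Type) (r : seq J) (G : J -> Sm) :
    rho (dmap (\sum_(x <- r) G x)) = \sum_(x <- r) rho (dmap (G x)).
  exact: (big_morph (rho \o @dmap K n D) rho_dmapD rho_dmap0).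
rewrite rho_sum -sumrB rpred_sum // => i _.
rewrite rho_sum -sumrB big_seq rpred_sum // => e ev.
rewrite /= dmapZ dmap_deltaZ -mpolyXD mul_mpolyC rhoZ.
rewrite rhoX; first by rewrite -scalerBr rpredZ.
rewrite mdegD /w -addSn leq_add //.
  by apply: leq_trans (leq_bigmax i); apply: msize_mdeg_lt.
exact: leq_bigmax.
Qed.

End TaylorSyzygies.

Arguments gen_set_inj {n D} [x1 x2].

(** * The zero-dimensional complex: its ideal and the embedding of [S/I] *)

Lemma cplx_dim0P (n : nat) (D : {set {set 'I_n}}) :
    is_complex D -> no_loops D -> cplx_dim D = 0 ->
  (0 < n)%N /\ forall F, (F \in D) = (#|F| <= 1)%N.
Proof.
move=> Dc Dl /eqP; rewrite /cplx_dim subr_eq0 => /eqP[D1].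
(* The maximum is attained by some face; its vertex also gives [0 < n]. *)
have [F FD F1] : exists2 F, F \in D & #|F| = 1%N.
  have [|F FD DF] := @eq_bigmax_cond _ (mem D) (fun F : {set 'I_n} => #|F|).
    rewrite lt0n; apply/eqP => /card0_eq D0; move: D1.
    by rewrite big_pred0.
  by exists F; rewrite -?DF.
have /cards1P[i0 Fi0] : #|F| == 1%N by rewrite F1.
split=> [|G]; first exact: leq_ltn_trans (ltn_ord i0).
apply/idP/idP => [GD|]; first
  by rewrite -D1 leq_bigmax_cond.
rewrite leq_eqVlt ltnS leqn0 cards_eq0 => /orP[/cards1P[i ->]|/eqP ->].
  exact: Dl.
exact: Dc FD (sub0set _).
Qed.

Section PointComplex.
Variables (K : fieldType) (n : nat) (D : {set {set 'I_n}}).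
Hypothesis n_gt0 : (0 < n)%N.
Hypothesis memD : forall F, (F \in D) = (#|F| <= 1)%N.
Local Notation S := {mpoly K[n]}.
Local Notation I := (@SR_ideal K n D).
Local Notation m := #|min_gens D|.
Local Notation Sm := 'rV[S]_m.
Implicit Types (F G H : {set 'I_n}) (i j : 'I_m) (k l : 'I_n) (f g : S).

Lemma mem_min_gens F : (F \in min_gens D) = (#|F| == 2).
Proof.
rewrite inE memD -ltnNge; apply/andP/eqP => [[F1 /forallP Fmin]|F2].
  have /card_gt1P[i [j [iF jF ij]]] := F1.
  have := Fmin [set i; j]; rewrite memD cards2 ij set_mnm_le /= subUset !sub1set.
  by rewrite iF jF => /eqP <-; rewrite cards2 ij.
split; first by rewrite F2.
apply/forallP => G; apply/implyP; rewrite memD set_mnm_le -ltnNge => /andP[G1 GF].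
by rewrite eqEcard GF F2.
Qed.

(** [I] is the ideal of the union of the coordinate axes: a monomial outside [I] has at most one
    variable and hence survives on some axis. *)
Lemma SR_idealP (f : S^o) : f \in I <-> forall l, res [set l] f = 0.
Proof.
split=> [|f0].
  pose N : {pred S^o} := [pred f | `[< forall l, res [set l] f = 0 >]].
  have Ncl : GRing.submod_closed N.
    split; first by apply/asboolP => l; rewrite raddf0.
    move=> a u v /asboolP u0 /asboolP v0; apply/asboolP => l.
    by rewrite -[a *: u]/(a * u) rmorphD rmorphM /= u0 v0 mulr0 addr0.
  move=> fI; apply/asboolP; move: f fI.
  apply: (gen_submod_min Ncl) => _ [F FD ->]; apply/asboolP => l.
  rewrite res_set_mnm ifN //; apply: contra FD => /subset_leq_card.
  by rewrite cards1 memD.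
rewrite [f]mpolyE big_seq rpred_sum // => e ef.
have supp_e : supp e \notin D.
  rewrite memD; apply/negP => e1.
  have [l el] : exists l, supp e \subset [set l].
    move: e1; rewrite leq_eqVlt ltnS leqn0 cards_eq0.
    case/orP => [/cards1P[l ->]|/eqP ->]; first by exists l.
    (* The constant monomial survives on every axis, and [0 < n] supplies one. *)
    by exists (Ordinal n_gt0); apply: sub0set.
  have := coeff_res [set l] f e; rewrite f0 mcoeff0 el => /esym/eqP.
  by rewrite mcoeff_eq0 ef.
have -> : f@_e *: 'X_[e] = (f@_e *: 'X_[e - set_mnm (supp e)] : S)
    *: ('X_[set_mnm (supp e)] : S^o).
  rewrite -[RHS]/(_ * _) -scalerAl -mpolyXD submK //.
  by apply/mnm_lepP => i; rewrite mnmE inE; case: (e i).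
by rewrite rpredZ // mem_gen_submod //; exists (supp e).
Qed.

Local Notation piI := (pi_mod I : S^o -> SR_ring K D).

Lemma piI_eq (f g : S^o) :
  piI f = piI g <-> forall l, res [set l] f = res [set l] g.
Proof.
rewrite pi_mod_eq SR_idealP; split=> h l; have := h l; rewrite raddfB /=.
  by move/eqP; rewrite subr_eq0 => /eqP.
by move=> ->; rewrite subrr.
Qed.

Lemma card_gen_set j : #|gen_set j| = 2.
Proof. by apply/eqP; rewrite -mem_min_gens enum_valP. Qed.

Lemma gen_setP F : #|F| = 2 -> {j : 'I_m | F = gen_set j}.
Proof.
move=> F2; have Fm : F \in min_gens D by rewrite mem_min_gens F2.
by exists (enum_rank_in Fm F); rewrite /gen_set enum_rankK_in.
Qed.

Lemma res_dmap F (v : Sm) :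
  res F (dmap v) = \sum_(j | gen_set j \subset F) res F (v 0 j) * 'X_[gen_mnm j].
Proof.
rewrite /dmap raddf_sum [RHS]big_mkcond /=; apply: eq_bigr => j _.
by rewrite rmorphM /= res_set_mnm; case: ifP; rewrite ?mulr0.
Qed.

(** No other edge lies inside [gen_set j], so restricting [dmap v = 0] to its two variables leaves a
    single product, whose monomial factor is nonzero. *)
Lemma syz_coord_vanishes (v : Sm) j F :
  v \in @syz_pred K n D -> F \subset gen_set j -> res F (v 0 j) = 0.
Proof.
move=> /eqP dv Fj; rewrite -(setIidPl Fj) -res_res.
suff -> : res (gen_set j) (v 0 j) = 0 by rewrite raddf0.
have := res_dmap (gen_set j) v; rewrite dv raddf0 (big_pred1 j) => [/esym/eqP|i].
  by rewrite mulf_eq0 (negPf (mpolyX_neq0 _ _)) orbF => /eqP.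
rewrite /= -(inj_eq gen_set_inj) eqEcard !card_gen_set andbT //.
Qed.

(** The coordinates of a Koszul relation are combinations of values of [dmap], and a generator with
    two variables dies on every axis. *)
Lemma kosz_coord_vanishes (v : Sm) j l :
  v \in @kosz_pred K n D -> res [set l] (v 0 j) = 0.
Proof.
pose N : {pred Sm} := [pred v : Sm | `[< forall j l, res [set l] (v 0 j) = 0 >]].
have Ncl : GRing.submod_closed N.
  split; first by apply/asboolP => i k; rewrite mxE raddf0.
  move=> a u w /asboolP u0 /asboolP w0; apply/asboolP => i k.
  by rewrite !mxE rmorphD rmorphM /= u0 w0 mulr0 addr0.
have dm0 (w : Sm) k : res [set k] (dmap w) = 0.
  rewrite res_dmap big_pred0 // => i; apply/negP => /subset_leq_card.
  by rewrite cards1 card_gen_set.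
move=> vK; suff /asboolP : v \in N by apply.
move: v vK; apply: (gen_submod_min Ncl) => _ [f [g ->]]; apply/asboolP => i k.
by rewrite !mxE rmorphB !rmorphM /= !dm0 !mul0r subr0.
Qed.

Lemma piI_repr (q : SR_ring K D) :
  piI (repr (q : Quotient.quot (submod_pred I))) = q.
Proof. by rewrite /pi_mod reprK. Qed.

(* [S/I] embeds into the product over [l] of the [K[x_l]], and [ev l] is the
   [l]-th component of this embedding. *)
Definition ev l (q : SR_ring K D) : S :=
  res [set l] (repr (q : Quotient.quot (submod_pred I)) : S).

Lemma ev_pi l (f : S^o) : ev l (piI f) = res [set l] f.
Proof. by apply: (piI_eq _ _).1; rewrite piI_repr. Qed.

Lemma ev_inj (q r : SR_ring K D) : (forall l, ev l q = ev l r) -> q = r.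
Proof. by move=> qr; rewrite -(piI_repr q) -(piI_repr r); apply/piI_eq. Qed.

Lemma evP l (a : S) (q r : SR_ring K D) :
  ev l (a *: q + r) = res [set l] a * ev l q + ev l r.
Proof.
rewrite -{1}(piI_repr q) -{1}(piI_repr r) -linearP ev_pi.
by rewrite -[a *: _]/(a * _) rmorphD rmorphM.
Qed.

Lemma ev0 l : ev l 0 = 0.
Proof. by rewrite -(linear0 (pi_mod I)) ev_pi raddf0. Qed.

Lemma evD l q r : ev l (q + r) = ev l q + ev l r.
Proof. by have := evP l 1 q r; rewrite scale1r rmorph1 mul1r. Qed.

Lemma evZ l a q : ev l (a *: q) = res [set l] a * ev l q.
Proof. by have := evP l a q 0; rewrite ev0 !addr0. Qed.

Lemma ev_sum l (J : Type) (r : seq J) (P : pred J) (q : J -> SR_ring K D) :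
  ev l (\sum_(j <- r | P j) q j) = \sum_(j <- r | P j) ev l (q j).
Proof. exact: (big_morph _ (evD l) (ev0 l)). Qed.

Lemma res_ev l q : res [set l] (ev l q) = ev l q.
Proof. by rewrite res_res setIid. Qed.

Lemma res0_ev k l q : res set0 (ev k q) = res set0 (ev l q).
Proof. by rewrite !res_res !set0I. Qed.

Lemma res_res_neq k l f : k != l -> res [set k] (res [set l] f) = res set0 f.
Proof.
move=> kl; rewrite res_res; congr (res _ f); apply/setP => x; rewrite !inE.
by case: eqP => // ->; rewrite (negPf kl).
Qed.

Lemma ev_divX l q : res set0 (ev l q) = 0 ->
  exists2 b, res [set l] b = b & ev l q = 'X_l * b.
Proof.
move=> q0; have [g eg] := res1_divX l (ev l q).
exists (res [set l] g); first by rewrite res_res setIid.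
by rewrite -res_ev eg q0 add0r.
Qed.

(** * The coordinate homomorphisms on [Syz/Kosz] *)

Local Notation Kos := (@Kosz K n D).
Local Notation piK := (pi_mod Kos).

Lemma syz_valD (s t : Syz K D) : syz_val (s + t) = syz_val s + syz_val t.
Proof. by []. Qed.
Lemma syz_valZ a (s : Syz K D) : syz_val (a *: s) = a *: syz_val s.
Proof. by []. Qed.

Lemma syz_val0 : syz_val (0 : Syz K D) = 0.
Proof. by []. Qed.

Lemma syz_in (s : Syz K D) : syz_val s \in @syz_pred K n D.
Proof. by case: s. Qed.

Definition coord_part i l (s : Syz K D) : SR_ring K D :=
  piI (res [set l] (syz_val s 0 i)).

(** On an axis other than [l], the scalar [a] multiplies only the constant term of a syzygy
    coordinate, which is zero. *)
Lemma coord_part_linear i l : linear (coord_part i l).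
Proof.
move=> a s t; apply: ev_inj => k; rewrite evP !ev_pi syz_valD syz_valZ !mxE.
move: (syz_coord_vanishes (syz_in s) (sub0set (gen_set i))).
move: (syz_val s 0 i) (syz_val t 0 i) => f g f0; rewrite 2!rmorphD 2!rmorphM /=.
case: (eqVneq k l) => [->|kl]; first by rewrite !res_res !setIid.
by rewrite !(res_res_neq _ kl) f0 !mulr0.
Qed.

Lemma coord_part_kosz i l s : s \in Kos -> coord_part i l s = 0.
Proof.
rewrite inE => sK; apply: ev_inj => k; rewrite ev0 ev_pi.
by rewrite kosz_coord_vanishes ?raddf0.
Qed.

(** It is zero for [l] in [gen_set i], by [syz_coord_vanishes]. *)
Definition coord_hom i l : HomSyzKosz K D :=
  hom_lift (coord_part_linear i l) (@coord_part_kosz i l).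

Arguments coord_hom : simpl never.

Lemma coord_homE i l (s : Syz K D) : coord_hom i l (piK s) = coord_part i l s.
Proof. exact: (quot_liftE (coord_part_linear i l) (@coord_part_kosz i l)). Qed.

Lemma ev_coord_hom k i l (s : Syz K D) :
  ev k (coord_hom i l (piK s)) = if k == l then res [set k] (syz_val s 0 i) else 0.
Proof.
rewrite coord_homE ev_pi; case: eqVneq => [->|kl]; first by rewrite res_res setIid.
by rewrite res_res_neq // (syz_coord_vanishes (syz_in s)) ?sub0set.
Qed.

Lemma ev_comb_coord_hom (al : 'I_m -> 'I_n -> K) k (s : Syz K D) :
  ev k ((\sum_i \sum_l (al i l)%:MP *: coord_hom i l) (piK s))
    = \sum_i (al i k)%:MP * res [set k] (syz_val s 0 i).
Proof.
rewrite Hom_sum ev_sum; apply: eq_bigr => i _.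
have term l : ev k (((al i l)%:MP *: coord_hom i l : HomSyzKosz K D) (piK s))
    = (al i l)%:MP * ev k (coord_hom i l (piK s)).
  by rewrite -[X in ev k X]/((al i l)%:MP *: coord_hom i l (piK s)) evZ resMP.
rewrite Hom_sum ev_sum (bigD1 k) // big1 => [|l lk].
  by rewrite [LHS]addr0 term ev_coord_hom eqxx.
by rewrite term ev_coord_hom eq_sym (negPf (andP lk).2) mulr0.
Qed.

(** * Maps on the free module and incidences of edges *)

Lemma taylor_in_syz i j : taylor K i j \in @syz_pred K n D.
Proof. by apply/eqP; exact: dmap_taylor. Qed.

Definition taylor_syz i j : Syz K D := MkSyz (taylor_in_syz i j).

Definition row_hom_fun (u : 'I_m -> SR_ring K D) (v : Sm) : SR_ring K D :=
  \sum_i v 0 i *: u i.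

Lemma row_hom_linear u : row_hom_fun u \in @linear_pred S Sm (SR_ring K D).
Proof.
apply/asboolP => a v w; rewrite /row_hom_fun scaler_sumr -big_split.
by apply: eq_bigr => i _; rewrite !mxE scalerDl scalerA.
Qed.

Definition row_hom u : Defs.Hom Sm (SR_ring K D) := Defs.MkHom (row_hom_linear u).

Lemma row_homE (psi : Defs.Hom Sm (SR_ring K D)) v :
  psi v = \sum_i v 0 i *: psi (delta_mx 0 i).
Proof.
by rewrite {1}[v]row_sum_delta linear_sum; apply: eq_bigr => i _; rewrite linearZ.
Qed.

Lemma gen_set_eq2 j k l : k != l -> k \in gen_set j -> l \in gen_set j ->
  gen_set j = [set k; l].
Proof.
move=> kl kj lj; apply/eqP; rewrite eq_sym eqEcard card_gen_set cards2 kl.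
by rewrite subUset !sub1set kj lj.
Qed.

Lemma gen_set_share i j : i != j -> ~~ [disjoint gen_set i & gen_set j] ->
  exists x y z, [/\ [&& x != y, x != z & y != z], gen_set i = [set x; y]
                  & gen_set j = [set x; z]].
Proof.
have other (h : 'I_m) x : x \in gen_set h ->
    exists2 y, x != y & gen_set h = [set x; y].
  move=> xh; have : #|gen_set h :\ x| == 1%N.
    have /eqP := cardsD1 x (gen_set h).
    by rewrite card_gen_set xh add1n eqSS eq_sym.
  case/cards1P => y hy; exists y.
    by have := set11 y; rewrite -hy !inE eq_sym => /andP[].
  by rewrite -(setD1K xh) hy.
move=> ij /pred0Pn[x /andP[/= xi xj]].
have [y xy iE] := other i x xi; have [z xz jE] := other j x xj.
exists x, y, z; split=> //; rewrite xy xz /=; apply: contra ij => /eqP yz.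
by apply/eqP/gen_set_inj; rewrite iE jE yz.
Qed.

(** For an edge [i] with ends x, y the witness is the edge joining x and [l]. On the axis [l] the
    Taylor syzygy of the two retains only coordinate [i], with coefficient ['X_l]. *)
Lemma gen_set_neighbor i l : l \notin gen_set i -> exists j : 'I_m,
  [/\ l \in gen_set j, gen_set j :\: gen_set i = [set l],
      gen_set i :|: gen_set j = l |: gen_set i
    & ~~ (gen_set i :\: gen_set j \subset [set l])].
Proof.
move=> li; have /cards2P[x [y [xy iE]]] : #|gen_set i| == 2.
  by rewrite card_gen_set.
have [lx ly] : l != x /\ l != y.
  by move: (li); rewrite iE !inE negb_or => /andP[].
have [|j jE] := gen_setP (F := [set x; l]); first by rewrite cards2 eq_sym lx.
exists j; rewrite iE -jE; split.
- by rewrite !inE eqxx orbT.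
- apply/setP => k; rewrite !inE; case: (eqVneq k l) => [->|_].
    by rewrite (negPf lx) (negPf ly).
  by case: (k == x); case: (k == y).
- apply/setP => k; rewrite !inE.
  by case: (k == x); case: (k == y); case: (k == l).
apply/subsetPn; exists y; last by rewrite inE eq_sym.
by rewrite !inE eqxx orbT ![y == _]eq_sym (negPf xy) (negPf ly).
Qed.

Lemma sum_taylor (b : 'I_m -> S) i j l :
  \sum_h res [set l] (taylor K i j 0 h) * b h =
    res [set l] 'X_[set_mnm (gen_set j :\: gen_set i)] * b i
    - res [set l] 'X_[set_mnm (gen_set i :\: gen_set j)] * b j.
Proof.
have sum_delta (f : S) (i' : 'I_m) :
    \sum_h res [set l] (f * (h == i')%:R) * b h = res [set l] f * b i'.
  rewrite (bigD1 i') //= eqxx mulr1 big1 ?addr0 // => h /negPf ->.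
  by rewrite mulr0 raddf0 mul0r.
rewrite -!sum_delta -sumrB; apply: eq_bigr => h _; rewrite !mxE /=.
by rewrite -mulrBl -rmorphB.
Qed.

Lemma taylor_homog i j : i != j ->
  homogSm (degZ (set_mnm (gen_set i :|: gen_set j))) (taylor K i j).
Proof.
move=> ij h e; rewrite !mxE /=.
case: (eqVneq h i) => [->|hi].
  rewrite (negPf ij) mulr1 mulr0 subr0 msuppX inE => /eqP ->.
  apply/ffunP => k; rewrite !ffunE !mnmE !inE.
  by case: (k \in gen_set i); case: (k \in gen_set j).
case: (eqVneq h j) => [->|hj].
  rewrite mulr1 mulr0 sub0r (perm_mem (msuppN _)) msuppX inE => /eqP ->.
  apply/ffunP => k; rewrite !ffunE !mnmE !inE.
  by case: (k \in gen_set i); case: (k \in gen_set j).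
by rewrite !mulr0 subr0 msupp0.
Qed.

(** * Values of a homomorphism on Taylor syzygies *)

Section Values.
Variable phi : HomSyzKosz K D.

Definition on_syz (s : Syz K D) : SR_ring K D := phi (piK s).

Lemma on_syzP a s t : on_syz (a *: s + t) = a *: on_syz s + on_syz t.
Proof. by rewrite /on_syz linearP [LHS]linearP. Qed.

Lemma on_syz_kosz s : syz_val s \in @kosz_pred K n D -> on_syz s = 0.
Proof.
move=> sK; rewrite /on_syz; suff -> : piK s = 0 by rewrite [LHS]linear0.
by rewrite -[RHS](linear0 (pi_mod Kos)); apply/pi_mod_eq; rewrite subr0 inE.
Qed.

Local Notation theta i j := (on_syz (taylor_syz i j)).

Lemma theta_rel (a b c : S) i1 j1 i2 j2 i3 j3 l :
    a *: taylor K i1 j1 + b *: taylor K i2 j2 + c *: taylor K i3 j3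
      \in @kosz_pred K n D ->
  res [set l] a * ev l (theta i1 j1) + res [set l] b * ev l (theta i2 j2)
    + res [set l] c * ev l (theta i3 j3) = 0.
Proof.
move=> relK.
(* The trailing zero gives the last summand the shape that [on_syzP] expects. *)
have : on_syz (a *: taylor_syz i1 j1 + (b *: taylor_syz i2 j2
                 + (c *: taylor_syz i3 j3 + 0))) = 0.
  apply: on_syz_kosz; rewrite !syz_valD !syz_valZ syz_val0.
  rewrite [X in _ + (_ + X)]addr0.
  rewrite addrA.
  exact: relK.
rewrite (on_syzP a) (on_syzP b) (on_syzP c) => /(congr1 (ev l)).
by rewrite !evP ev0 [on_syz 0]on_syz_kosz ?rpred0 // ev0 addr0 addrA.
Qed.

Lemma theta_anti i j l : ev l (theta j i) = - ev l (theta i j).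
Proof.
have -> : taylor_syz j i = - taylor_syz i j.
  by apply: val_inj; rewrite /= /taylor [RHS]opprB.
have -> : on_syz (- taylor_syz i j) = - on_syz (taylor_syz i j).
  by rewrite /on_syz [X in phi X]linearN [LHS]linearN.
by rewrite -scaleN1r evZ rmorphN1 mulN1r.
Qed.

Lemma theta_diag i l : ev l (theta i i) = 0.
Proof.
rewrite on_syz_kosz ?ev0 //.
by have -> : syz_val (taylor_syz i i) = 0 by [exact: subrr]; exact: rpred0.
Qed.

(* Multiplying a Taylor syzygy by the gcd of the two generators gives a Koszul
   relation. *)
Lemma theta_kosz i j l : gen_set i :&: gen_set j \subset [set l] ->
  ev l (theta i j) = 0.
Proof.
move=> sl; set F := _ :&: _ in sl.
have := @theta_rel 'X_[set_mnm F] 0 0 i j i i i i l.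
rewrite raddf0 !mul0r !addr0 res_set_mnm sl => h; apply/eqP.
have /eqP : 'X_[set_mnm F] * ev l (theta i j) = 0.
  apply: h; rewrite !scale0r !addr0; apply: mem_gen_submod.
  exists (delta_mx 0 j), (delta_mx 0 i).
  rewrite /taylor scalerBr !scalerA -!mpolyXD.
  rewrite -[delta_mx 0 j]scale1r -[delta_mx 0 i]scale1r !dmap_deltaZ !mul1r.
  rewrite !scale1r; congr ('X_[_] *: _ - 'X_[_] *: _).
    by apply/mnmP => k; rewrite !mnmE !inE; do 2!case: (_ \in _).
  by apply/mnmP => k; rewrite !mnmE !inE; do 2!case: (_ \in _).
by rewrite mulf_eq0 (negPf (mpolyX_neq0 _ _)).
Qed.

(** Lifted to the degree of [F], the three Taylor syzygies sum to zero by telescoping. *)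
Lemma theta_cocycle i j h l F : F = gen_set i :|: gen_set j :|: gen_set h ->
  res [set l] 'X_[set_mnm (F :\: (gen_set i :|: gen_set j))] * ev l (theta i j)
  + res [set l] 'X_[set_mnm (F :\: (gen_set j :|: gen_set h))] * ev l (theta j h)
  + res [set l] 'X_[set_mnm (F :\: (gen_set h :|: gen_set i))] * ev l (theta h i)
  = 0.
Proof.
move=> ->; apply: theta_rel; rewrite !scale_taylor.
- by rewrite add_cyclic_sub; exact: rpred0.
all: by apply/subsetP => k; rewrite !inE;
  move: (k \in gen_set i) (k \in gen_set j) (k \in gen_set h) => [] [] [].
Qed.

(** In the cocycle with the edge joining [x] and [l], the other two values are multiplied by ['X_y]
    and ['X_z], which vanish on the axis [l], and this one by ['X_l]. *)
Lemma theta_third i j x y z l :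
    [&& x != y, x != z & y != z] -> l \notin [set x; y; z] ->
  gen_set i = [set x; y] -> gen_set j = [set x; z] -> ev l (theta i j) = 0.
Proof.
rewrite !inE !negb_or -andbA => /and3P[xy xz yz] /and3P[lx ly lz] iE jE.
have [|h hE] := gen_setP (F := [set x; l]); first by rewrite cards2 eq_sym lx.
have := theta_cocycle l (erefl (gen_set i :|: gen_set j :|: gen_set h));
  rewrite iE jE -hE.
set F := _ :|: _ :|: _.
have -> : F :\: ([set x; y] :|: [set x; z]) = [set l].
  apply/setP => k; rewrite !inE; case: (eqVneq k l) => [->|_].
    by rewrite (negPf lx) (negPf ly) (negPf lz).
  by case: (k == x); case: (k == y); case: (k == z).
have -> : F :\: ([set x; z] :|: [set x; l]) = [set y].
  apply/setP => k; rewrite !inE; case: (eqVneq k y) => [->|_].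
    by rewrite ![y == _]eq_sym (negPf xy) (negPf ly) [z == y]eq_sym (negPf yz).
  by case: (k == x); case: (k == z); case: (k == l).
have -> : F :\: ([set x; l] :|: [set x; y]) = [set z].
  apply/setP => k; rewrite !inE; case: (eqVneq k z) => [->|_].
    by rewrite ![z == _]eq_sym (negPf xz) (negPf lz) (negPf yz).
  by case: (k == x); case: (k == y); case: (k == l).
rewrite !res_set_mnm !sub1set !inE eqxx ![_ == l]eq_sym (negPf ly) (negPf lz).
rewrite !mul0r !addr0 => /eqP.
by rewrite mulf_eq0 (negPf (mpolyX_neq0 _ _)) => /eqP.
Qed.

(** The candidates for [j] join [l] to an end of [i]. The three edges form a triangle, so all
    cocycle coefficients are 1, and the two candidates share only [l], so their mutual value on that
    axis vanishes by [theta_kosz]. *)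
Lemma theta_common i l : l \notin gen_set i -> exists2 a, res set0 a = 0 &
  forall j, l \in gen_set j -> ~~ [disjoint gen_set i & gen_set j] ->
    ev l (theta i j) = a.
Proof.
move=> li; have /cards2P[x [y [xy iE]]] : #|gen_set i| == 2.
  by rewrite card_gen_set.
have [lx ly] : l != x /\ l != y.
  by move: li; rewrite iE !inE negb_or => /andP[].
have [|j0 j0E] := gen_setP (F := [set x; l]); first by rewrite cards2 eq_sym lx.
exists (ev l (theta i j0)).
  (* Constant terms agree on all axes, and on the axis [x], the common vertex of [i] and [j0], the
     value is zero. *)
  rewrite (res0_ev l x) theta_kosz ?raddf0 // iE -j0E; apply/subsetP => k.
  rewrite !inE; case: (k == x) => //= /andP[/eqP -> /eqP yl].
  by rewrite yl eqxx in ly.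
move=> j lj /pred0Pn[x' /andP[/= xi xj]].
have lx' : x' != l by apply: contraNneq li => <-.
have jE := gen_set_eq2 lx' xj lj.
move: xi; rewrite iE !inE => /orP[/eqP xx'|/eqP yx'].
  by congr (ev l (theta i _)); apply: gen_set_inj; rewrite jE xx'.
subst x'.
have := theta_cocycle l (erefl (gen_set i :|: gen_set j :|: gen_set j0)).
rewrite iE jE -j0E.
set F := _ :|: _ :|: _.
have sF (A B : {set 'I_n}) : F \subset A :|: B -> F :\: (A :|: B) = set0.
  by move=> FAB; apply/eqP; rewrite setD_eq0.
rewrite !{}sF.
- rewrite res_set_mnm sub0set set_mnm0 mpolyX0 !mul1r.
  rewrite [ev l (theta j j0)]theta_kosz ?addr0.
    by rewrite [ev l (theta j0 i)]theta_anti => /eqP; rewrite subr_eq0 => /eqP.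
  rewrite jE -j0E; apply/subsetP => k; rewrite !inE.
  case: (k == l); rewrite ?orbT ?orbF // => /andP[/eqP -> /eqP yx].
  by rewrite yx eqxx in xy.
all: by apply/subsetP => k; rewrite !inE;
  case: (k == x); case: (k == y); case: (k == l).
Qed.

(* [theta_common] says that, up to sign, [ev l (phi (taylor i j))] for [l] in
   [gen_set j] only depends on [i] and [l]; it has no constant term, and [b i l]
   is its quotient by [x_l]. *)
Lemma theta_coefs : exists b : 'I_m -> 'I_n -> S,
  [/\ forall i l, res [set l] (b i l) = b i l,
      forall i l, l \in gen_set i -> b i l = 0
    & forall i j l, ev l (theta i j) =
        res [set l] 'X_[set_mnm (gen_set j :\: gen_set i)] * b i l
        - res [set l] 'X_[set_mnm (gen_set i :\: gen_set j)] * b j l].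
Proof.
pose P (il : 'I_m * 'I_n) (b : S) := [/\ res [set il.2] b = b,
  il.2 \in gen_set il.1 -> b = 0 & il.2 \notin gen_set il.1 -> forall j,
    il.2 \in gen_set j -> ~~ [disjoint gen_set il.1 & gen_set j] ->
    ev il.2 (theta il.1 j) = 'X_(il.2) * b].
have [|b bP] := @choice _ _ P.
  move=> [i l]; rewrite /P /=; case: (boolP (l \in gen_set i)) => li.
    by exists 0; rewrite raddf0.
  have [a a0 ai] := theta_common li.
  have [/existsP[j /andP[lj ij]]|/existsPn nj] := boolP [exists j : 'I_m,
    (l \in gen_set j) && ~~ [disjoint gen_set i & gen_set j]].
    move: a0; rewrite -(ai j lj ij) => a0.
    have [b bl eb] := ev_divX a0; exists b; split=> // _ j' lj' ij'.
    by rewrite (ai j' lj' ij') -(ai j lj ij).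
  exists 0; rewrite raddf0; split=> // _ j lj ij.
  by have := nj j; rewrite lj ij.
exists (fun i l => b (i, l)); split=> [i l|i l li|i j l].
- by case: (bP (i, l)).
- by case: (bP (i, l)) => _ /= ->.
case: (eqVneq i j) => [->|ij]; first by rewrite theta_diag subrr.
(* Disjoint edges: the Taylor syzygy is Koszul, and both coefficients involve two variables. *)
case: (boolP [disjoint gen_set i & gen_set j]) => dij.
  have res0 (h h' : 'I_m) : [disjoint gen_set h & gen_set h'] ->
      res [set l] 'X_[set_mnm (gen_set h :\: gen_set h')] = 0 :> S.
    move=> dh; rewrite res_set_mnm (setDidPl dh) ifN //.
    by apply/negP => /subset_leq_card; rewrite cards1 card_gen_set.
  rewrite !res0 ?mul0r ?subr0 //; last by rewrite disjoint_sym.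
  by rewrite theta_kosz // (disjoint_setI0 dij) sub0set.
have [x [y [z [xyz iE jE]]]] := gen_set_share ij dij.
have /and3P[xy xz yz] := xyz.
have -> : gen_set j :\: gen_set i = [set z].
  rewrite iE jE; apply/setP => k; rewrite !inE; case: (eqVneq k z) => [->|_].
    by rewrite ![z == _]eq_sym (negPf xz) (negPf yz).
  by case: (k == x); case: (k == y).
have -> : gen_set i :\: gen_set j = [set y].
  rewrite iE jE; apply/setP => k; rewrite !inE; case: (eqVneq k y) => [->|_].
    by rewrite (negPf yz) eq_sym (negPf xy).
  by case: (k == x); case: (k == z).
(* The axes [z] and [y] carry the two coefficients; [x] is settled by [theta_kosz], all further axes
   by [theta_third]. *)
rewrite !res_set_mnm !sub1set !inE !set_mnm1.
case: (eqVneq z l) => [zl|zl].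
  rewrite -zl (negPf yz) mul0r subr0; case: (bP (i, z)) => _ _; apply => //=.
    by rewrite iE !inE ![z == _]eq_sym (negPf xz) (negPf yz).
  by rewrite jE !inE eqxx orbT.
case: (eqVneq y l) => [yl|yl].
  rewrite -yl mul0r sub0r -[LHS]opprK -theta_anti; congr (- _).
  case: (bP (j, y)) => _ _; apply => /=; last by rewrite disjoint_sym.
    by rewrite jE !inE [y == x]eq_sym (negPf xy) (negPf yz).
  by rewrite iE !inE eqxx orbT.
rewrite !mul0r subr0; case: (eqVneq x l) => [xl|xl].
  apply: theta_kosz; rewrite -xl iE jE; apply/subsetP => k; rewrite !inE.
  case: (k == x) => //= /andP[/eqP -> /eqP yz']; by rewrite yz' eqxx in yz.
apply: theta_third xyz _ iE jE.
by rewrite !inE !negb_or ![l == _]eq_sym xl yl zl.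
Qed.

(** Both sides are linear in [s], so the Taylor syzygies decide. *)
Lemma on_syz_coefs (b : 'I_m -> 'I_n -> S) :
    (forall i j l, ev l (theta i j) =
        res [set l] 'X_[set_mnm (gen_set j :\: gen_set i)] * b i l
        - res [set l] 'X_[set_mnm (gen_set i :\: gen_set j)] * b j l) ->
  forall s l, ev l (on_syz s) = \sum_i res [set l] (syz_val s 0 i) * b i l.
Proof.
move=> thE s.
(* Generation is a statement in [Sm], so the property carries a lift [t] to [Syz]. *)
pose N : {pred Sm} := [pred v : Sm | `[< exists2 t : Syz K D, syz_val t = v &
  forall l, ev l (on_syz t) = \sum_i res [set l] (v 0 i) * b i l >]].
have Ncl : GRing.submod_closed N.
  split.
    apply/asboolP; exists 0 => [|l]; first exact: syz_val0.
    rewrite on_syz_kosz ?syz_val0 ?rpred0 // ev0 big1 // => i _.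
    by rewrite mxE raddf0 mul0r.
  move=> a v w /asboolP[s1 <- e1] /asboolP[s2 <- e2]; apply/asboolP.
  exists (a *: s1 + s2) => [|l]; first by rewrite syz_valD syz_valZ.
  rewrite on_syzP evP e1 e2 mulr_sumr -big_split; apply: eq_bigr => i _ /=.
  by rewrite !mxE rmorphD rmorphM mulrDl mulrA.
have /asboolP[t ts tE] : syz_val s \in N.
  move: (syz_val s) (syz_gen_taylor (syz_in s)).
  apply: (gen_submod_min Ncl) => _ [i [j ->]]; apply/asboolP.
  by exists (taylor_syz i j) => // l; rewrite sum_taylor -thE.
by move=> l; rewrite -tE; congr (ev l (on_syz _)); apply: val_inj.
Qed.

(** The syzygy has the degree of [l |: gen_set i], while a term in ['X_l] has that of [l]; the shift
    is the difference. *)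
Lemma homog_coef (c : {ffun 'I_n -> int}) i j l : homogHom c phi ->
    gen_set i :|: gen_set j = l |: gen_set i -> l \notin gen_set i ->
  (ev l (theta i j))@_U_(l) != 0 -> c = - degZ (@gen_mnm n D i).
Proof.
move=> phi_c ijE li.
have ij : i != j.
  apply: contraNneq li => jE; move: (setU11 l (gen_set i)).
  by rewrite -ijE -jE setUid.
have [|f fh fE] := phi_c (degZ (set_mnm (gen_set i :|: gen_set j)))
  (piK (taylor_syz i j)).
  by exists (taylor_syz i j) => //; apply: taylor_homog.
rewrite /on_syz fE ev_pi coeff_res -set_mnm1 supp_set_mnm subxx mcoeff_eq0 negbK.
move=> /fh /ffunP cE; apply/ffunP => k; have := cE k.
rewrite ijE !ffunE !mnmE !inE; case: (eqVneq k l) => [->|kl].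
  by rewrite (negPf li) /=; lia.
by rewrite /=; case: (k \in gen_set i) => /=; lia.
Qed.

Lemma hom_decomposition : exists (al : 'I_m -> 'I_n -> K)
    (psi : Defs.Hom Sm (SR_ring K D)),
  (forall s : Syz K D, phi (piK s) = psi (syz_val s)
        + (\sum_i \sum_l (al i l)%:MP *: coord_hom i l) (piK s)) /\
  (forall c, homogHom c phi -> forall i l, al i l != 0 ->
     c = - degZ (@gen_mnm n D i)).
Proof.
have [b [bl b0 thE]] := theta_coefs.
pose al i l := (b i l)@_0%MM.
(* The summands have no constant term, so on the axis [k] only the one with [l = k] survives. *)
pose u i : S^o := \sum_l (b i l - (al i l)%:MP).
have uE i k : res [set k] (u i) = b i k - (al i k)%:MP.
  rewrite /u raddf_sum (bigD1 k) //= rmorphB /= resMP bl big1 ?addr0 // => l lk.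
  rewrite rmorphB /= resMP -bl res_res_neq 1?eq_sym // res_set0.
  by rewrite /al subrr.
(* The constant terms of the [b i l] are the obstruction; the higher terms come
   from the map sending the i-th basis vector to [u i]. *)
exists al, (row_hom (fun i => piI (u i))); split=> [s|c phi_c i l ali].
  apply: ev_inj => k; rewrite evD ev_comb_coord_hom (on_syz_coefs thE).
  rewrite /= /row_hom_fun ev_sum -big_split; apply: eq_bigr => i _ /=.
  by rewrite evZ ev_pi uE [X in _ + X]mulrC -mulrDr subrK.
have li : l \notin gen_set i.
  by apply: contraNN ali => li; rewrite /al b0 ?mcoeff0.
(* On this syzygy the coefficient of ['X_l] in the value is exactly [al i l]. *)
have [j [lj ji ijE nij]] := gen_set_neighbor li.
apply: (@homog_coef c i j l) => //.
rewrite thE (b0 _ _ lj) mulr0 subr0 ji.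
rewrite res_set_mnm subxx set_mnm1 mulrC.
by have := mcoeffMX (b i l) U_(l) 0; rewrite addm0 => ->.
Qed.

End Values.

(** * Generators and relations of [T2], and its graded pieces *)

Local Notation restr := (@restr_image K n D).
Local Notation piT := (pi_mod restr).

Definition T2_class i l : T2 K D := piT (coord_hom i l).

Definition T2_comb (al : 'I_m -> 'I_n -> K) : T2 K D :=
  \sum_i \sum_l (al i l)%:MP *: T2_class i l.

Lemma T2_combE al :
  T2_comb al = piT (\sum_i \sum_l (al i l)%:MP *: coord_hom i l).
Proof.
rewrite [RHS]linear_sum; apply: eq_bigr => i _.
by rewrite [RHS]linear_sum; apply: eq_bigr => l _; rewrite [RHS]linearZ.
Qed.

Lemma T2_combB al be :
  T2_comb al - T2_comb be = T2_comb (fun i l => al i l - be i l).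
Proof.
rewrite /T2_comb -sumrB; apply: eq_bigr => i _; rewrite -sumrB.
by apply: eq_bigr => l _; rewrite mpolyCB scalerBl.
Qed.

Lemma T2_span (phi : HomSyzKosz K D) : exists2 al, piT phi = T2_comb al &
  forall c, homogHom c phi -> forall i l, al i l != 0 ->
    c = - degZ (@gen_mnm n D i).
Proof.
have [al [psi [phiE alc]]] := hom_decomposition phi.
exists al => //; rewrite T2_combE; apply/pi_mod_eq/asboolP; exists psi => s.
by rewrite -[LHS]/(phi (piK s) - _ (piK s)) phiE addrK.
Qed.

(** If a map [psi] on [Sm] induces the combination, neighbour syzygies show that [al i k] is the
    constant term of [psi (delta_mx 0 i)], which is the same on all axes. *)
Lemma T2_comb_eq0 al : T2_comb al = 0 <->
  (forall i k l, k \notin gen_set i -> l \notin gen_set i -> al i k = al i l).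
Proof.
rewrite T2_combE -[X in _ = X](linear0 (pi_mod restr)) pi_mod_eq subr0.
split=> [/asboolP[psi psiE] i|al_const].
  suff coefE k : k \notin gen_set i ->
      (al i k)%:MP = res set0 (ev k (psi (delta_mx 0 i))).
    move=> k l ki li; apply: (can_inj (@mpolyCK n K)).
    by rewrite (coefE k ki) (coefE l li) (res0_ev k l).
  move=> ki; have [j [kj ji _ ij]] := gen_set_neighbor ki.
  have := congr1 (ev k) (psiE (taylor_syz i j)).
  rewrite ev_comb_coord_hom row_homE ev_sum.
  under eq_bigr do rewrite mulrC.
  under [in RHS]eq_bigr do rewrite evZ.
  rewrite !(sum_taylor (fun h => _)) ji res_set_mnm subxx.
  rewrite res_set_mnm (negPf ij) !mul0r !subr0.
  move/(mulfI (mpolyX_neq0 _ _)) => <-; by rewrite resMP.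
apply/asboolP.
(* The common value of [al i] off the edge; the default 0 occurs only if the edge contains all
   vertices. *)
pose c i := if [pick k | k \notin gen_set i] is Some k then al i k else 0.
exists (row_hom (fun i => piI ((c i)%:MP : S^o))) => s; apply: ev_inj => k.
rewrite ev_comb_coord_hom /= /row_hom_fun ev_sum; apply: eq_bigr => i _.
rewrite evZ ev_pi resMP mulrC; case: (boolP (k \in gen_set i)) => ki.
  by rewrite (syz_coord_vanishes (syz_in s)) ?sub1set // !mul0r.
rewrite /c; case: pickP => [k' k'i|/(_ k)]; last by rewrite ki.
by rewrite (al_const i k k').
Qed.

(** Restriction to an axis only deletes monomials, so the shift is that of reading off coordinate
    [i]. *)
Lemma coord_hom_homog i l : homogHom (- degZ (@gen_mnm n D i)) (coord_hom i l).
Proof.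
move=> u x [s su ->]; rewrite coord_homE.
exists (res [set l] (syz_val s 0 i)) => // e.
rewrite -[e \in _]negbK -mcoeff_eq0 coeff_res.
case: ifP => _; last by rewrite eqxx.
by rewrite mcoeff_eq0 negbK; apply: su.
Qed.

Lemma cardsC_gen_set i : #|~: gen_set i| = (n - 2)%N.
Proof. by rewrite cardsCs setCK card_gen_set card_ord. Qed.

(** At most one vertex lies off an edge, so every coefficient family is constant there. *)
Lemma T2_small (t : T2 K D) : (n <= 3)%N -> t = 0.
Proof.
move=> n3; case: (pi_mod_surj t) => phi ->; have [al -> _] := T2_span phi.
apply/T2_comb_eq0 => i k l ki li; suff -> : k = l by [].
have /card_le1_eqP : (#|~: gen_set i| <= 1)%N.
  by rewrite cardsC_gen_set; lia.
by apply; rewrite inE.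
Qed.

Lemma T2_class_comb i (B : {set 'I_n}) (a : 'I_n -> K) :
  \sum_(l in B) (a l)%:MP *: T2_class i l
    = T2_comb (fun j l => if (j == i) && (l \in B) then a l else 0).
Proof.
rewrite /T2_comb (bigD1 i) //= [X in _ + X]big1 ?addr0 => [|j ji].
  rewrite big_mkcond; apply: eq_bigr => l _; rewrite eqxx /=.
  by case: ifP; rewrite // scale0r.
by rewrite big1 // => l _; rewrite (negPf ji) scale0r.
Qed.

Lemma T2_large : (3 < n)%N -> exists t : T2 K D, t <> 0.
Proof.
move=> n3; have lt n' : (n' < 2)%N -> (n' < n)%N by lia.
have [|i _] := gen_setP (F := [set Ordinal (lt 0%N isT); Ordinal (lt 1%N isT)]).
  by rewrite cards2.
have /card_gt1P[k [l [ki li kl]]] : (1 < #|~: gen_set i|)%N.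
  by rewrite cardsC_gen_set; lia.
(* Its coefficients off the edge are 1 at [k] and 0 at [l], hence not constant. *)
exists (\sum_(h in [set k]) 1%:MP *: T2_class i h).
rewrite (T2_class_comb i [set k] (fun=> 1)) => /T2_comb_eq0/(_ i k l).
rewrite !inE in ki li; rewrite !inE !eqxx eq_sym (negPf kl) => /(_ ki li)/eqP.
by rewrite oner_eq0.
Qed.

Lemma T2_comp_eq0 c (t : T2 K D) :
  (forall i, c <> - degZ (@gen_mnm n D i)) -> T2_comp c t -> t = 0.
Proof.
move=> nc [phi phi_c ->]; have [al -> alc] := T2_span phi.
suff al0 i l : al i l = 0 by apply/T2_comb_eq0 => i k l _ _; rewrite !al0.
by apply/eqP/negPn/negP => /(alc _ phi_c)/nc.
Qed.

(** The classes [T2_class i l] off the edge have sum zero as their only relation, so dropping one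
    vertex [l0] leaves a basis. *)
Lemma T2_comp_dim i : (3 <= n)%N ->
  has_dimK (@T2_comp K n D (- degZ (@gen_mnm n D i))) (n - 3).
Proof.
move=> n3; have /card_gt0P[l0] : (0 < #|~: gen_set i|)%N.
  by rewrite cardsC_gen_set; lia.
rewrite inE => l0i; pose B := ~: gen_set i :\ l0.
have -> : (n - 3)%N = #|B|.
  have := cardsD1 l0 (~: gen_set i).
  by rewrite cardsC_gen_set !inE l0i -/B; lia.
apply: (has_dimK_finset (f := T2_class i)) => [l _|a a0 l lB|t [phi phi_c ->]].
- by exists (coord_hom i l) => //; apply: coord_hom_homog.
- have l0B : l0 \in B = false by rewrite !inE eqxx.
  have li : l \notin gen_set i by move: lB; rewrite !inE => /andP[].
  move: a0; rewrite T2_class_comb => /T2_comb_eq0/(_ i l l0 li l0i).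
  by rewrite lB l0B eqxx.
have [al -> alc] := T2_span phi; exists (fun l => al i l - al i l0).
(* The difference of the two combinations is constant off every edge: [al i l0] for the edge [i],
   and 0 for the others, whose degrees differ. *)
apply/eqP; rewrite -subr_eq0 T2_class_comb T2_combB; apply/eqP/T2_comb_eq0 => j.
suff diffE k : k \notin gen_set j -> (al j k -
      if (j == i) && (k \in B) then al i k - al i l0 else 0)
    = if j == i then al i l0 else 0.
  by move=> k l kj lj; rewrite !diffE.
move=> kj; case: (eqVneq j i) => [ji|ji].
  rewrite ji in kj *; rewrite !inE kj andbT; case: eqVneq => [->|_] /=.
    by rewrite subr0.
  by rewrite opprB addrC subrK.
rewrite subr0; apply/eqP; apply: contraNT ji => /(alc _ phi_c)/oppr_inj/esym.
by move/gen_mnm_inj/eqP.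
Qed.

End PointComplex.

Theorem lemma3p1 (K : fieldType) (n : nat) (Delta : {set {set 'I_n}})
    (Delta_complex : is_complex Delta)
    (Delta_no_loops : no_loops Delta)
    (Delta_dim0 : cplx_dim Delta = 0) :
  (forall a b : 'X_{1..n},
     (forall i, (b i <= 1)%N) ->
     [disjoint supp a & supp b] ->
     has_dimK (fun t : T2 K Delta => T2_comp (degZ a - degZ b) t)
       (if (a == 0%MM) && (#|supp b| == 2%N) then maxn (n - 3) 0 else 0%N)) /\
  ((forall t : T2 K Delta, t = 0) <-> (n <= 3)%N).
Proof.
have [n_gt0 memD] := cplx_dim0P Delta_complex Delta_no_loops Delta_dim0.
split=> [a b b1 ab|]; last first.
  split=> [T0|n3 t]; last exact: (T2_small n_gt0 memD).
  by rewrite leqNgt; apply/negP => /(T2_large K n_gt0 memD)[t]; apply.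
case: ifP => [/andP[/eqP -> /eqP b2]|nab].
  rewrite maxn0; have [i iE] := gen_setP memD b2.
  have -> : degZ 0%MM - degZ b = - degZ (gen_mnm i).
    apply/ffunP => k; rewrite !ffunE mnm0E sub0r /gen_mnm -/(gen_set i) -iE.
    by rewrite mnmE inE; have := b1 k; case: (b k) => [|[]].
  (* For [n < 3] the subtraction truncates to 0, in agreement with [T2_small]. *)
  have [n3|n3] := leqP 3 n; first exact: (T2_comp_dim K n_gt0 memD).
  have /eqP -> : (n - 3 == 0)%N by rewrite subn_eq0 ltnW.
  by apply: has_dimK0 => t _; apply: (T2_small n_gt0 memD); apply: ltnW.
apply: has_dimK0 => t; apply: (T2_comp_eq0 n_gt0 memD) => i /(degZB_gen ab).
by case=> a0 bE; move: nab; rewrite a0 bE eqxx (card_gen_set memD).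
Qed.
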